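(* Let $p\geq 2$ and let $G$ be a $2p$-regular graph. Then $G$ is $(p+2)$-star colourable if and only if $G$ admits a $(p+2)$-colourful Eulerian orientation.
   Context: A $k$-star colouring is a proper vertex colouring with $k$ colours in which no path on 4 vertices receives only two colours. An orientation of $G$ is obtained by directing each edge. An Eulerian orientation is one in which every vertex has in-degree equal to out-degree. An Eulerian orientation $\vec G$ of $G$ is a $q$-colourful Eulerian orientation if there exists a proper $q$-colouring $f$ of $G$ such that for every vertex $v$: (i) all in-neighbours of $v$ have the same colour $c_v$; (ii) no out-neighbour of $v$ has colour $c_v$; (iii) the out-neighbours of $v$ have pairwise distinct colours. *)

(* Defs.v *)
(* A finite simple graph is a symmetric irreflexive relation
   [e] on a finType [T]; an orientation of it is a relation [o] of arcs, where
   [o u v] is the arc from [u] to [v]. *)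
From mathcomp Require Import all_boot.
Set Implicit Arguments.
Unset Strict Implicit.
Unset Printing Implicit Defensive.

Definition regular_graph (T : finType) (e : rel T) (d : nat) : Prop :=
  forall v : T, #|[set w | e v w]| = d.

Definition proper_colouring (T : finType) (e : rel T) (k : nat)
    (f : T -> 'I_k) : Prop :=
  forall u v : T, e u v -> f u != f v.

(* The 4-vertex paths are subgraphs, not necessarily induced. *)
Definition star_colouring (T : finType) (e : rel T) (k : nat)
    (f : T -> 'I_k) : Prop :=
  proper_colouring e f /\
  forall a b c d : T, uniq [:: a; b; c; d] -> path e a [:: b; c; d] ->
    2 < #|f @: [set a; b; c; d]|.

Definition star_colourable (T : finType) (e : rel T) (k : nat) : Prop :=
  exists f : T -> 'I_k, star_colouring e f.

Definition orientation (T : finType) (e o : rel T) : Prop :=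
  (forall u v : T, e u v = o u v || o v u) /\
  (forall u v : T, o u v -> ~~ o v u).

Definition in_nbrs (T : finType) (o : rel T) (v : T) : {set T} :=
  [set u | o u v].

Definition out_nbrs (T : finType) (o : rel T) (v : T) : {set T} :=
  [set w | o v w].

Definition eulerian_orientation (T : finType) (e o : rel T) : Prop :=
  orientation e o /\ forall v : T, #|in_nbrs o v| = #|out_nbrs o v|.

Definition colourful_eulerian_orientation (T : finType) (e : rel T) (q : nat)
    (o : rel T) : Prop :=
  eulerian_orientation e o /\
  exists f : T -> 'I_q, proper_colouring e f /\
    forall v : T, exists c : 'I_q,
      [/\ {in in_nbrs o v, forall u, f u = c},
          {in out_nbrs o v, forall w, f w != c} &
          {in out_nbrs o v &, injective f}].

(* Main.v *)
(* In a star colouring [f], say that a vertex [w] is a leaf towards a colour [j]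
   when exactly one neighbour of [w] has colour [j], and orient an edge [w v]
   from [w] to [v] when [w] is a leaf towards [f v].  Since bicoloured components
   are stars, every edge receives at least one direction.  The out-degree of
   [w] is the number of colours towards which it is a leaf; this is at most [p],
   because [2 * p > p + 1] neighbours cannot all have distinct colours among the
   [p + 1] colours other than [f w].  As there are [p * #|T|] edges, every
   out-degree is exactly [p] and no edge receives both directions.  Exactly one
   colour other than [f w] is then left over, and all in-neighbours have it. *)
Require Import Defs.
From mathcomp Require Import all_boot zify.

Set Implicit Arguments.
Unset Strict Implicit.
Unset Printing Implicit Defensive.

Section StarColouring.

Variables (T : finType) (e : rel T).
Hypothesis e_sym : symmetric e.

(** The middle edge of a 4-vertex path is directed one way or the other, and its tail then has two
    path neighbours of different colours; with the tail itself this makes three colours. *)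
Lemma star_of_colourful (q : nat) (o : rel T) :
  colourful_eulerian_orientation e q o -> star_colourable e q.
Proof.
move=> [[[e_o _] _] [f [f_proper f_col]]]; exists f; split=> // a b c d.
(* If [z] is an out-neighbour of [x], this is injectivity; if it is an in-neighbour, its colour is
   the one that out-neighbours avoid. *)
have key x y z : o x y -> e x z -> z != y -> f z != f y.
  move=> oxy; rewrite e_o => /orP[oxz|ozx] zy;
    have [k [kin kout kinj]] := f_col x.
    by apply: contra_neq zy; apply: kinj; rewrite inE.
  by rewrite (kin z) ?inE // eq_sym kout // inE.
rewrite /= !inE !negb_or !andbT -!andbA.
move=> /and5P[ab ac ad bc /andP[bd cd]] /and3P[eab ebc ecd].
have gt2 x y z : f x != f y -> f y != f z -> f x != f z ->
    [set x; y; z] \subset [set a; b; c; d] -> 2 < #|f @: [set a; b; c; d]|.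
  move=> xy yz xz /(imsetS f)/subset_leq_card; apply: leq_trans.
  by rewrite !imsetU !imset_set1 -setUA cardsU1 cards2 !inE negb_or xy xz yz.
have sub1 : [set a; b; c] \subset [set a; b; c; d] by apply: subsetUl.
have sub2 : [set b; c; d] \subset [set a; b; c; d].
  by apply/subsetP=> x; rewrite !inE => /orP[/orP[]|] ->; rewrite ?orbT.
move: (ebc); rewrite e_o => /orP[obc|ocb].
  apply: (gt2 a b c) => //; try exact: f_proper.
  by apply: (key b c a); rewrite // e_sym.
apply: (gt2 b c d) => //; try exact: f_proper.
by rewrite eq_sym; apply: (key c b d); rewrite // eq_sym.
Qed.

Variables (q : nat) (f : T -> 'I_q).

Definition leaf_colours (w : T) : {set 'I_q} :=
  [set j | #|[set v | e w v & f v == j]| == 1].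

Definition leaf_arc : rel T := [rel w v | e w v && (f v \in leaf_colours w)].

Lemma leaf_arc_inj (w : T) : {in out_nbrs leaf_arc w &, injective f}.
Proof.
move=> u v; rewrite !inE => /andP[ewu uA] /andP[ewv _] fuv.
have /cards1P[x Dx]: #|[set z | e w z & f z == f u]| == 1 by rewrite inE in uA.
have: u \in [set x] by rewrite -Dx inE ewu eqxx.
have: v \in [set x] by rewrite -Dx inE ewv fuv eqxx.
by rewrite !inE => /eqP-> /eqP->.
Qed.

Lemma imset_leaf_arc (w : T) : f @: out_nbrs leaf_arc w = leaf_colours w.
Proof.
apply/setP=> j; apply/imsetP/idP=> [[v] | jA].
  by rewrite inE => /andP[_ ?] ->.
have /cards1P[v Dv] : #|[set v | e w v & f v == j]| == 1 by rewrite inE in jA.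
have : v \in [set v] by rewrite inE.
by rewrite -Dv inE => /andP[ewv /eqP fv]; exists v; rewrite // inE /leaf_arc /= ewv fv.
Qed.

Lemma card_out_leaf_arc (w : T) : #|out_nbrs leaf_arc w| = #|leaf_colours w|.
Proof. by rewrite -imset_leaf_arc card_in_imset //; apply: leaf_arc_inj. Qed.

Lemma notin_leaf_colours (w : T) :
  proper_colouring e f -> f w \notin leaf_colours w.
Proof.
move=> f_proper; rewrite -imset_leaf_arc; apply/imsetP=> -[v].
by rewrite inE => /andP[/f_proper/eqP].
Qed.

Lemma edge_leaf_arc (w v : T) :
  star_colouring e f -> e w v = leaf_arc w v || leaf_arc v w.
Proof.
move=> [f_proper f_star]; apply/idP/idP => [ewv|]; last first.
  by case/orP=> /andP[]; rewrite // e_sym.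
apply: contraT.
(* Failing to be a leaf towards [f y] means a second neighbour of that colour. Twins at both ends of
   an undirected edge give the bicoloured path [v' w v w']. *)
have twin x y : e x y -> ~~ leaf_arc x y ->
    exists z, [/\ z != y, e x z & f z = f y].
  move=> exy; rewrite /leaf_arc /= exy !inE (cardsD1 y).
  rewrite !inE exy eqxx eqSS cards_eq0 /= => /set0Pn[z].
  by rewrite !inE => /and3P[zy exz /eqP fz]; exists z.
have evw : e v w by rewrite e_sym.
rewrite negb_or => /andP[/(twin _ _ ewv)[v' [v'v ewv' fv']]].
move=> /(twin _ _ evw)[w' [w'w evw' fw']].
have nwv := f_proper _ _ ewv.
have neq x y : f x != f y -> x != y by apply: contra_neq => ->.
have := f_star v' w v w'; rewrite /= !inE !negb_or e_sym ewv' ewv evw' v'v.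
rewrite (eq_sym w w') w'w !neq ?fv' ?fw' // 1?eq_sym // => /(_ isT isT).
rewrite !imsetU !imset_set1 fv' fw'.
suff -> : [set f v; f w; f v; f w] = [set f v; f w] by rewrite cards2; case: eqP.
by rewrite -setUA setUid.
Qed.

End StarColouring.

Section Regular.

Variables (p : nat) (T : finType) (e : rel T).
Hypotheses (e_sym : symmetric e) (p_ge2 : 2 <= p).
Hypothesis e_reg : regular_graph e (2 * p).
Variable f : T -> 'I_(p + 2).
Hypothesis f_star : star_colouring e f.

Let f_proper : proper_colouring e f := proj1 f_star.
Let A := leaf_colours e f.
Let o := leaf_arc e f.

Lemma card_leaf_colours_le (w : T) : #|A w| <= p.
Proof.
have sA : A w \subset [set~ f w].
  by rewrite subsetC sub1set inE notin_leaf_colours.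
rewrite leqNgt; apply/negP=> ltpA.
have cardC : #|[set~ f w]| = p.+1 by rewrite cardsC1 card_ord addn2.
have AE : A w = [set~ f w] by apply/eqP; rewrite eqEcard sA cardC.
(* Every neighbour is now an out-neighbour, so the degree would be [p.+1], which is less than
   [2 * p]. *)
have : out_nbrs o w = [set v | e w v].
  apply/setP=> v; rewrite !inE /o /leaf_arc /=; case ewv: (e w v) => //=.
  by rewrite -/A -/(A w) AE !inE eq_sym f_proper.
move/(congr1 (fun B : {set T} => #|B|)).
by rewrite card_out_leaf_arc -/(A w) AE cardC e_reg; lia.
Qed.

Lemma leaf_arc_tight :
  (forall w, #|A w| = p) /\ (forall w v, ~~ (o w v && o v w)).
Proof.
have sum_out : \sum_w \sum_v o w v = \sum_w #|A w|.
  by apply: eq_bigr => w _; rewrite -card_out_leaf_arc -sum1dep_card [RHS]big_mkcond.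
have sum_in : \sum_w \sum_v o v w = \sum_w #|A w| by rewrite exchange_big.
have sum_e : \sum_w \sum_v e w v = \sum_(w : T) 2 * p.
  by apply: eq_bigr => w _; rewrite -(e_reg w) -sum1dep_card [RHS]big_mkcond.
have sum_split : \sum_w \sum_v e w v + \sum_w \sum_v (o w v && o v w)
    = \sum_w \sum_v o w v + \sum_w \sum_v o v w.
  rewrite -!big_split; apply: eq_bigr => w _; rewrite -!big_split.
  apply: eq_bigr => v _ /=; rewrite (edge_leaf_arc e_sym w v f_star).
  by rewrite -/(o w v) -/(o v w); case: (o w v); case: (o v w).
(* The subtraction is not truncated, by the bound on [#|A w|]. *)
have sum_def : \sum_w #|A w| + \sum_w (p - #|A w|) = \sum_(w : T) p.
  rewrite -big_split; apply: eq_bigr => w _ /=.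
  by rewrite subnKC // card_leaf_colours_le.
have sum_2p : \sum_(w : T) 2 * p = 2 * \sum_(w : T) p by rewrite big_distrr.
(* Together the identities say that twice the total deficit plus the count of doubly directed pairs
   is zero. *)
have [d0 b0] : \sum_w (p - #|A w|) = 0 /\
  \sum_w \sum_v (o w v && o v w) = 0 by lia.
split=> [w|w v].
  move/eqP: d0; rewrite sum_nat_eq0 => /forallP/(_ w)/=.
  by rewrite subn_eq0 => lepA; apply/eqP; rewrite eqn_leq card_leaf_colours_le.
move/eqP: b0; rewrite sum_nat_eq0 => /forallP/(_ w)/=.
by rewrite sum_nat_eq0 => /forallP/(_ v)/=; rewrite eqb0.
Qed.

Lemma colourful_of_star : colourful_eulerian_orientation e (p + 2) o.
Proof.
have [cardA o_asym] := leaf_arc_tight.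
have e_o u v : e u v = o u v || o v u by apply: edge_leaf_arc.
split; first split; first split=> // u v ouv.
- by have := o_asym u v; rewrite ouv.
- move=> v; have := e_reg v.
  have -> : [set w | e v w] = out_nbrs o v :|: in_nbrs o v.
    by apply/setP=> w; rewrite !inE e_o.
  rewrite cardsU (_ : _ :&: _ = set0) ?cards0; last first.
    by apply/setP=> w; rewrite !inE (negbTE (o_asym v w)).
  by rewrite card_out_leaf_arc -/(A v) cardA; lia.
exists f; split=> // v.
(* Of the [p + 2] colours, [f v] and the [p] colours of [A v] leave one for the in-neighbours. *)
have /cards1P[c cE] : #|~: (f v |: A v)| == 1.
  have := cardsC (f v |: A v).
  by rewrite cardsU1 notin_leaf_colours // -/(A v) cardA card_ord; lia.
have cP j : (j == c) = ~~ ((j == f v) || (j \in A v)).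
  by have /setP/(_ j) := cE; rewrite in_setC in_setU1 in_set1.
exists c; split; last exact: leaf_arc_inj.
  (* If [f u] were in [A v], the edge would be directed both ways. *)
  move=> u; rewrite inE => ouv; apply/eqP; rewrite cP negb_or.
  have euv : e u v by rewrite e_o ouv.
  rewrite f_proper //=; have := o_asym u v.
  by rewrite ouv /= /o /leaf_arc /= e_sym euv.
by move=> w; rewrite inE => /andP[_ wA]; rewrite cP negbK [f w \in A v]wA orbT.
Qed.

End Regular.

Unset Implicit Arguments.

Theorem theorem8 (p : nat) (T : finType) (e : rel T)
    (e_sym : symmetric e) (e_irr : irreflexive e)
    (p_ge2 : 2 <= p) (e_reg : regular_graph e (2 * p)) :
  star_colourable e (p + 2) <->
  exists o : rel T, colourful_eulerian_orientation e (p + 2) o.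
Proof.
split=> [[f f_star]|[o]]; last exact: star_of_colourful.
by exists (leaf_arc e f); apply: colourful_of_star.
Qed.
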